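(* Let $C=(C_\bullet,b,B)$ and $\bar C=(\bar C_\bullet,b,B)$ be parachain complexes of $k$-modules. Let $f:C_\bullet\to\bar C_\bullet$ and $g:\bar C_\bullet\to C_\bullet$ be $k$-linear maps commuting with $b$, and $\varphi:C_\bullet\to C_{\bullet+1}$ a $k$-linear map, such that $fg=1$ and $gf=1+b\varphi+\varphi b$. Let $f^\natural,g^\natural,\varphi^\natural,\tilde B$ be as defined in the context. Suppose that $f,g,\varphi$ are $T$-compatible (commute with the $T$-operators) and $\varphi$ is special ($f\varphi=0$, $\varphi g=0$, $\varphi^2=0$). Then: (i) $\tilde C^\natural:=(\bar C^\natural_\bullet,b+\tilde Bu^{-1},u^{-1},T)$ is a para-$S$-module. (ii) $f^\natural:C^\natural_\bullet\to\tilde C^\natural_\bullet$ and $g^\natural:\tilde C^\natural_\bullet\to C^\natural_\bullet$ are $S$-maps such that $$f^\natural g^\natural=1,\qquad g^\natural f^\natural=1+(b+Bu^{-1})\varphi^\natural+\varphi^\natural(b+Bu^{-1}).$$ In particular, we obtain an $S$-deformation retract of $C^\natural$ to $\tilde C^\natural$, and a $T$-deformation retract of $C^\sharp$ to $\tilde C^\sharp$. (iii) The chain homotopy $\varphi^\natural$ is special, i.e. $f^\natural\varphi^\natural=0$, $\varphi^\natural g^\natural=0$, $(\varphi^\natural)^2=0$.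
   Context: $k$ is a unital ring, not assumed commutative; $k$-modules are left modules. A para-$S$-module $(C_\bullet,d,S,T)$ consists of $k$-modules $C_m$ ($m\ge 0$), $k$-linear maps $d:C_\bullet\to C_{\bullet-1}$, $S:C_\bullet\to C_{\bullet-2}$ and a $k$-linear isomorphism $T:C_\bullet\to C_\bullet$ such that $d^2=S(1-T)$ and $d,S,T$ commute pairwise. An $S$-map is a degree $0$ $k$-linear map commuting with $d,S,T$. An $S$-deformation retract of $C$ to $\bar C$ is given by $S$-maps $f:C_\bullet\to\bar C_\bullet$, $g:\bar C_\bullet\to C_\bullet$ with $fg=1$ and $gf=1+d\varphi+\varphi d$ for a $k$-linear $\varphi$ of degree $+1$ commuting with $S$ and $T$. The periodic para-complex of a para-$S$-module is $C^\sharp=(C^\sharp_0\oplus C^\sharp_1,d,T)$, where $C_i^\sharp=\varprojlim_SC_{2q+i}=\{(x_{2q+i})_{q\ge0}:Sx_{2q+2+i}=x_{2q+i}\}$ and $d$ (odd), $T$ (even) are induced from $d,T$, using the shift identification $\varprojlim_SC_{2q+2}\simeq\varprojlim_SC_{2q}$; $C^\sharp$ and $\tilde C^\sharp$ denote those of $C^\natural$ and $\tilde C^\natural$. A $T$-deformation retract of periodic para-complexes is a deformation retract (for the operators $d$) whose maps and homotopy commute with $T$. A parachain complex $(C_\bullet,b,B)$ consists of $k$-modules $C_m$ ($m\ge0$) and $k$-linear maps $b:C_\bullet\to C_{\bullet-1}$, $B:C_\bullet\to C_{\bullet+1}$ with $b^2=0$, $B^2=0$, such that $T:=1-(bB+Bb)$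 is an isomorphism. Put $C^\natural_m=\bigoplus_{p\ge0,\,2p\le m}C_{m-2p}u^p$, $u$ a formal variable; $u^{-1}(xu^p)=xu^{p-1}$ for $p\ge1$, $u^{-1}(xu^0)=0$; other operators act on coefficients. $C^\natural=(C^\natural_\bullet,b+Bu^{-1},u^{-1},T)$ is a para-$S$-module. Definitions: $\varphi^\natural=\sum_{j\ge0}\varphi(B\varphi)^ju^{-j}:C^\natural_\bullet\to C^\natural_{\bullet+1}$; $f^\natural=f+\sum_{j\ge1}f(B\varphi)^ju^{-j}:C^\natural_\bullet\to\bar C^\natural_\bullet$; $g^\natural=g+\sum_{j\ge1}(\varphi B)^jg\,u^{-j}:\bar C^\natural_\bullet\to C^\natural_\bullet$; $\tilde B=\sum_{j\ge0}f(B\varphi)^jBg\,u^{-j}:\bar C^\natural_\bullet\to\bar C^\natural_{\bullet+1}$. *)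

(* Defs.v *)
From HB Require Import structures.
From mathcomp Require Import all_boot all_order all_algebra.
From mathcomp Require Import boolp.

Set Implicit Arguments.
Unset Strict Implicit.
Unset Printing Implicit Defensive.

Import GRing.Theory.
Local Open Scope ring_scope.

(* Conventions.  A graded k-module is a family C : nat -> lmodType k, with
   C_m = 0 understood for m < 0.  A map of degree -1 (resp. -2) is a family
   C m.+1 -> C m (resp. C m.+2 -> C m); it is zero on the remaining low
   degrees.  Identities between operators are stated in every degree where
   they are not of the form 0 = 0. *)

Definition mklin (k : pzRingType) (U V : lmodType k) (F : U -> V)
    (H : linear F) : {linear U -> V} :=
  HB.pack F (GRing.isLinear.Build k U V *:%R F H).

Section LinearMaps.
Variables (k : pzRingType) (U V U' V' : lmodType k).

Fact prod_map_linear (F : {linear U -> U'}) (G : {linear V -> V'}) :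
  linear (fun x : U * V => (F x.1, G x.2)).
Proof. by move=> a x y; rewrite /= !linearP. Qed.
Definition prod_map F G : {linear (U * V)%type -> (U' * V')%type} :=
  mklin (@prod_map_linear F G).

Fact inl_map_linear (F : {linear U -> U'}) :
  linear (fun x => (F x, 0) : U' * V').
Proof.
move=> a x y; rewrite linearP; congr pair.
by rewrite /= scaler0 addr0.
Qed.
Definition inl_map F : {linear U -> (U' * V')%type} :=
  mklin (@inl_map_linear F).

Fact fst_map_linear (F : {linear U -> U'}) : linear (fun x : U * V => F x.1).
Proof. by move=> a x y; rewrite /= linearP. Qed.
Definition fst_map F : {linear (U * V)%type -> U'} :=
  mklin (@fst_map_linear F).

Fact snd_map_linear : linear (fun x : U * V => x.2).
Proof. by []. Qed.
Definition snd_map : {linear (U * V)%type -> V} := mklin snd_map_linear.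

End LinearMaps.

Section Graded.
Variable k : pzRingType.
Implicit Types (C D E : nat -> lmodType k).

Definition updown C D E (F : forall m, {linear D m -> E m.+1})
    (G : forall m, {linear C m.+1 -> D m}) (m : nat) : {linear C m -> E m} :=
  match m with
  | 0 => \0
  | m'.+1 => F m' \o G m'
  end.

Record parachain_data := ParachainData {
  pch_mod :> nat -> lmodType k;
  pch_b : forall m, {linear pch_mod m.+1 -> pch_mod m};
  pch_B : forall m, {linear pch_mod m -> pch_mod m.+1} }.

Definition pch_T (C : parachain_data) (m : nat) : {linear C m -> C m} :=
  idfun \- ((pch_b C m \o pch_B C m) \+ updown (pch_B C) (pch_b C) m).

Record parachain := Parachain {
  pch_data :> parachain_data;
  pch_bb : forall m (x : pch_data m.+2),
    pch_b pch_data m (pch_b pch_data m.+1 x) = 0;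
  pch_BB : forall m (x : pch_data m),
    pch_B pch_data m.+1 (pch_B pch_data m x) = 0;
  pch_T_bij : forall m, bijective (pch_T pch_data m) }.

Record paraS_data := ParaSData {
  ps_mod :> nat -> lmodType k;
  ps_d : forall m, {linear ps_mod m.+1 -> ps_mod m};
  ps_S : forall m, {linear ps_mod m.+2 -> ps_mod m};
  ps_T : forall m, {linear ps_mod m -> ps_mod m} }.

Record is_paraS (X : paraS_data) : Prop := IsParaS {
  ps_T_bij : forall m, bijective (ps_T X m);
  ps_dd : forall m (x : X m.+2),
    ps_d X m (ps_d X m.+1 x) = ps_S X m (x - ps_T X m.+2 x);
  ps_dS : forall m (x : X m.+3),
    ps_d X m (ps_S X m.+1 x) = ps_S X m (ps_d X m.+2 x);
  ps_dT : forall m (x : X m.+1), ps_d X m (ps_T X m.+1 x) = ps_T X m (ps_d X m x);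
  ps_ST : forall m (x : X m.+2), ps_S X m (ps_T X m.+2 x) = ps_T X m (ps_S X m x) }.

Record paraS := ParaS {
  ps_data :> paraS_data;
  ps_axioms : is_paraS ps_data }.

Record is_Smap (X Y : paraS_data) (f : forall m, {linear X m -> Y m}) : Prop :=
  IsSmap {
  Smap_d : forall m (x : X m.+1), f m (ps_d X m x) = ps_d Y m (f m.+1 x);
  Smap_S : forall m (x : X m.+2), f m (ps_S X m x) = ps_S Y m (f m.+2 x);
  Smap_T : forall m (x : X m), f m (ps_T X m x) = ps_T Y m (f m x) }.

Record is_S_deformation_retract (X Y : paraS_data)
    (f : forall m, {linear X m -> Y m}) (g : forall m, {linear Y m -> X m})
    (phi : forall m, {linear X m -> X m.+1}) : Prop := IsSDR {
  sdr_f : is_Smap f;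
  sdr_g : is_Smap g;
  sdr_fg : forall m (y : Y m), f m (g m y) = y;
  sdr_gf : forall m (x : X m),
    g m (f m x) = x + ps_d X m (phi m x) + updown phi (ps_d X) m x;
  sdr_phiS : forall m (x : X m.+2),
    phi m (ps_S X m x) = ps_S X m.+1 (phi m.+2 x);
  (* [phi S = S phi] in degree 1, where S itself vanishes *)
  sdr_phiS1 : forall x : X 1, ps_S X 0 (phi 1 x) = 0;
  sdr_phiT : forall m (x : X m), phi m (ps_T X m x) = ps_T X m.+1 (phi m x) }.

Section InverseLimit.
Variables (D : nat -> lmodType k) (s : forall q, {linear D q.+1 -> D q}).

Record invlim := InvLim {
  il_seq :> forall q, D q;
  il_compat : forall q, s q (il_seq q.+1) = il_seq q }.

HB.instance Definition _ := gen_eqMixin invlim.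
HB.instance Definition _ := gen_choiceMixin invlim.

Lemma invlimP (x y : invlim) : (forall q, x q = y q) -> x = y.
Proof.
case: x y => [x xP] [y yP] /= exy.
have {}exy : x = y by apply: functional_extensionality_dep.
by case: y / exy yP => yP; congr InvLim; apply: Prop_irrelevance.
Qed.

Fact il0_compat q : s q 0 = 0. Proof. exact: linear0. Qed.
Definition il0 := InvLim il0_compat.
Fact ilN_compat (x : invlim) q : s q (- x q.+1) = - x q.
Proof. by rewrite linearN il_compat. Qed.
Definition ilN x := InvLim (ilN_compat x).
Fact ilD_compat (x y : invlim) q : s q (x q.+1 + y q.+1) = x q + y q.
Proof. by rewrite linearD !il_compat. Qed.
Definition ilD x y := InvLim (ilD_compat x y).
Fact ilZ_compat a (x : invlim) q : s q (a *: x q.+1) = a *: x q.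
Proof. by rewrite linearZ /= il_compat. Qed.
Definition ilZ a x := InvLim (ilZ_compat a x).

Fact ilDA : associative ilD.
Proof. by move=> x y z; apply: invlimP => q /=; rewrite addrA. Qed.
Fact ilDC : commutative ilD.
Proof. by move=> x y; apply: invlimP => q /=; rewrite addrC. Qed.
Fact il0D : left_id il0 ilD.
Proof. by move=> x; apply: invlimP => q /=; rewrite add0r. Qed.
Fact ilND : left_inverse il0 ilN ilD.
Proof. by move=> x; apply: invlimP => q /=; rewrite addNr. Qed.
HB.instance Definition _ := GRing.isZmodule.Build invlim ilDA ilDC il0D ilND.

Fact ilZA a b x : ilZ a (ilZ b x) = ilZ (a * b) x.
Proof. by apply: invlimP => q /=; rewrite scalerA. Qed.
Fact il1Z : left_id 1 ilZ.
Proof. by move=> x; apply: invlimP => q /=; rewrite scale1r. Qed.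
Fact ilZDr : right_distributive ilZ +%R.
Proof. by move=> a x y; apply: invlimP => q /=; rewrite scalerDr. Qed.
Fact ilZDl x : {morph ilZ^~ x : a b / a + b}.
Proof. by move=> a b; apply: invlimP => q /=; rewrite scalerDl. Qed.
HB.instance Definition _ :=
  GRing.Zmodule_isLmodule.Build k invlim ilZA il1Z ilZDr ilZDl.

End InverseLimit.

Section InverseLimitMaps.
Variables (D : nat -> lmodType k) (s : forall q, {linear D q.+1 -> D q}).
Variables (E : nat -> lmodType k) (t : forall q, {linear E q.+1 -> E q}).

Section Map.
Variable h : forall q, {linear D q -> E q}.
Hypothesis h_compat : forall q (x : D q.+1), h q (s q x) = t q (h q.+1 x).

Fact lim_map_compat (x : invlim s) q : t q (h q.+1 (x q.+1)) = h q (x q).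
Proof. by rewrite -h_compat il_compat. Qed.
Fact lim_map_linear : linear (fun x => InvLim (lim_map_compat x)).
Proof. by move=> a x y; apply: invlimP => q /=; rewrite linearP. Qed.
Definition lim_map : {linear invlim s -> invlim t} := mklin lim_map_linear.
End Map.

(* The shift identification of the limit of D_q with the limit of D_{q+1}. *)
Fact lim_shift_compat (x : invlim s) q : s q.+1 (x q.+2) = x q.+1.
Proof. exact: il_compat. Qed.
Fact lim_shift_linear : linear (fun x : invlim s => @InvLim (fun q => D q.+1)
  (fun q => s q.+1) (fun q => x q.+1) (lim_shift_compat x)).
Proof. by move=> a x y; apply: invlimP. Qed.
Definition lim_shift : {linear invlim s -> invlim (fun q => s q.+1)} :=
  mklin lim_shift_linear.

Fact lim_unshift_compat (x : invlim (fun q => s q.+1)) q :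
  s q (s q.+1 (x q.+1)) = s q (x q).
Proof. by rewrite (il_compat x). Qed.
Fact lim_unshift_linear :
  linear (fun x : invlim (fun q => s q.+1) =>
    @InvLim D s (fun q => s q (x q)) (lim_unshift_compat x)).
Proof. by move=> a x y; apply: invlimP => q /=; rewrite linearP. Qed.
Definition lim_unshift : {linear invlim (fun q => s q.+1) -> invlim s} :=
  mklin lim_unshift_linear.

Lemma lim_shiftK : cancel lim_shift lim_unshift.
Proof. by move=> x; apply: invlimP => q /=; rewrite il_compat. Qed.
Lemma lim_unshiftK : cancel lim_unshift lim_shift.
Proof. by move=> x; apply: invlimP => q /=; rewrite (il_compat x). Qed.

End InverseLimitMaps.

(* [X_0 (+) X_1] with d odd and T even, given by their components. *)
Record para_complex := ParaComplex {
  pc0 : lmodType k;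
  pc1 : lmodType k;
  pc_d01 : {linear pc0 -> pc1};
  pc_d10 : {linear pc1 -> pc0};
  pc_T0 : {linear pc0 -> pc0};
  pc_T1 : {linear pc1 -> pc1} }.

(* The maps f = (f0, f1), g = (g0, g1) are even, the homotopy
   phi = (phi01, phi10) is odd. *)
Record is_T_deformation_retract (X Y : para_complex)
    (f0 : {linear pc0 X -> pc0 Y}) (f1 : {linear pc1 X -> pc1 Y})
    (g0 : {linear pc0 Y -> pc0 X}) (g1 : {linear pc1 Y -> pc1 X})
    (phi01 : {linear pc0 X -> pc1 X}) (phi10 : {linear pc1 X -> pc0 X}) : Prop :=
  IsTDR {
  tdr_fd0 : forall x, f1 (pc_d01 X x) = pc_d01 Y (f0 x);
  tdr_fd1 : forall x, f0 (pc_d10 X x) = pc_d10 Y (f1 x);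
  tdr_gd0 : forall y, g1 (pc_d01 Y y) = pc_d01 X (g0 y);
  tdr_gd1 : forall y, g0 (pc_d10 Y y) = pc_d10 X (g1 y);
  tdr_fg0 : forall y, f0 (g0 y) = y;
  tdr_fg1 : forall y, f1 (g1 y) = y;
  tdr_gf0 : forall x, g0 (f0 x) = x + pc_d10 X (phi01 x) + phi10 (pc_d01 X x);
  tdr_gf1 : forall x, g1 (f1 x) = x + pc_d01 X (phi10 x) + phi01 (pc_d10 X x);
  tdr_fT0 : forall x, f0 (pc_T0 X x) = pc_T0 Y (f0 x);
  tdr_fT1 : forall x, f1 (pc_T1 X x) = pc_T1 Y (f1 x);
  tdr_gT0 : forall y, g0 (pc_T0 Y y) = pc_T0 X (g0 y);
  tdr_gT1 : forall y, g1 (pc_T1 Y y) = pc_T1 X (g1 y);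
  tdr_phiT0 : forall x, phi01 (pc_T0 X x) = pc_T1 X (phi01 x);
  tdr_phiT1 : forall x, phi10 (pc_T1 X x) = pc_T0 X (phi10 x) }.

Section Sharp.
Variable X : paraS.

Definition S_even q : {linear X q.*2.+2 -> X q.*2} := ps_S X q.*2.
Definition S_odd q : {linear X q.*2.+3 -> X q.*2.+1} := ps_S X q.*2.+1.

Definition sharp0 : lmodType k := @invlim (fun q => X q.*2) S_even.
Definition sharp1 : lmodType k := @invlim (fun q => X q.*2.+1) S_odd.

Fact sharp_d01_compat q (x : X q.+1.*2.+2) :
  ps_d X q.*2.+1 (ps_S X q.*2.+2 x) = ps_S X q.*2.+1 (ps_d X q.*2.+3 x).
Proof. exact: (ps_dS (ps_axioms X)). Qed.
Definition sharp_d01 : {linear sharp0 -> sharp1} :=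
  @lim_map _ (fun q => S_even q.+1) _ S_odd
    (fun q => ps_d X q.*2.+1) sharp_d01_compat \o lim_shift S_even.

Fact sharp_d10_compat q (x : X q.+1.*2.+1) :
  ps_d X q.*2 (ps_S X q.*2.+1 x) = ps_S X q.*2 (ps_d X q.*2.+2 x).
Proof. exact: (ps_dS (ps_axioms X)). Qed.
Definition sharp_d10 : {linear sharp1 -> sharp0} :=
  @lim_map _ S_odd _ S_even (fun q => ps_d X q.*2) sharp_d10_compat.

Fact sharp_T0_compat q (x : X q.+1.*2) :
  ps_T X q.*2 (ps_S X q.*2 x) = ps_S X q.*2 (ps_T X q.*2.+2 x).
Proof. by rewrite (ps_ST (ps_axioms X)). Qed.
Fact sharp_T1_compat q (x : X q.+1.*2.+1) :
  ps_T X q.*2.+1 (ps_S X q.*2.+1 x) = ps_S X q.*2.+1 (ps_T X q.*2.+3 x).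
Proof. by rewrite (ps_ST (ps_axioms X)). Qed.

Definition sharp : para_complex :=
  {| pc0 := sharp0; pc1 := sharp1;
     pc_d01 := sharp_d01; pc_d10 := sharp_d10;
     pc_T0 := @lim_map _ S_even _ S_even (fun q => ps_T X q.*2) sharp_T0_compat;
     pc_T1 := @lim_map _ S_odd _ S_odd (fun q => ps_T X q.*2.+1) sharp_T1_compat |}.

End Sharp.

Section SharpMap.
Variables (X Y : paraS) (f : forall m, {linear X m -> Y m}).
Hypothesis fS : is_Smap f.

Definition sharp_map0 : {linear pc0 (sharp X) -> pc0 (sharp Y)} :=
  @lim_map _ (S_even X) _ (S_even Y) (fun q => f q.*2)
    (fun q => Smap_S fS (m := q.*2)).
Definition sharp_map1 : {linear pc1 (sharp X) -> pc1 (sharp Y)} :=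
  @lim_map _ (S_odd X) _ (S_odd Y) (fun q => f q.*2.+1)
    (fun q => Smap_S fS (m := q.*2.+1)).
End SharpMap.

Section SharpHomotopy.
Variables (X : paraS) (phi : forall m, {linear X m -> X m.+1}).
Hypothesis phiS : forall m (x : X m.+2),
  phi m (ps_S X m x) = ps_S X m.+1 (phi m.+2 x).

Definition sharp_homotopy01 : {linear pc0 (sharp X) -> pc1 (sharp X)} :=
  @lim_map _ (S_even X) _ (S_odd X) (fun q => phi q.*2)
    (fun q => @phiS q.*2).
Definition sharp_homotopy10 : {linear pc1 (sharp X) -> pc0 (sharp X)} :=
  lim_unshift (S_even X) \o
  @lim_map _ (S_odd X) _ (fun q => S_even X q.+1) (fun q => phi q.*2.+1)
    (fun q => @phiS q.*2.+1).
End SharpHomotopy.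

(* Recursive form of the direct sum of the C_{m-2p} u^p over 2p <= m: the pair
   (x, y) in degree m+2 stands for x u^0 + y u, so that an element of degree m
   is the nested tuple of its coefficients at u^0, u^1, ... *)
Fixpoint natural C (m : nat) : lmodType k :=
  match m with
  | 0 => C 0
  | 1 => C 1
  | m'.+2 => (C m'.+2 * natural C m')%type
  end.

Definition uinv C (m : nat) : {linear natural C m.+2 -> natural C m} :=
  snd_map (C m.+2) (natural C m).

(* Action on coefficients of a graded map of degree 0, 1 and -1 respectively;
   in degree 1 a map of degree 1 creates a zero coefficient at u^1, and a map
   of degree -1 kills the coefficient of degree 0. *)
Fixpoint coef0 C D (F : forall m, {linear C m -> D m}) (m : nat) :
    {linear natural C m -> natural D m} :=
  match m with
  | 0 => F 0
  | 1 => F 1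
  | m'.+2 => prod_map (F m'.+2) (coef0 F m')
  end.

Fixpoint coefU C D (F : forall m, {linear C m -> D m.+1}) (m : nat) :
    {linear natural C m -> natural D m.+1} :=
  match m with
  | 0 => F 0
  | 1 => inl_map (D 0) (F 1)
  | m'.+2 => prod_map (F m'.+2) (coefU F m')
  end.

Fixpoint coefD C D (F : forall m, {linear C m.+1 -> D m}) (m : nat) :
    {linear natural C m.+1 -> natural D m} :=
  match m with
  | 0 => F 0
  | 1 => fst_map (C 0) (F 1)
  | m'.+2 => prod_map (F m'.+2) (coefD F m')
  end.

Definition mul_uinv C D (F : forall m, {linear natural C m -> natural D m.+1})
    (m : nat) : {linear natural C m.+1 -> natural D m} :=
  match m with
  | 0 => \0
  | m'.+1 => F m' \o uinv C m'
  end.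

(* [pow_uinv X h j] is X^j h u^{-j}, for X of degree 2. *)
Fixpoint pow_uinv C (E : nat -> lmodType k) (X : forall m, {linear E m -> E m.+2})
    (h : forall m, {linear natural C m -> E m}) (j m : nat) :
    {linear natural C m -> E m} :=
  match j with
  | 0 => h m
  | j'.+1 =>
    match m with
    | m'.+2 => X m' \o (pow_uinv X h j' m' \o uinv C m')
    | _ => \0
    end
  end.

Lemma nat_ind2 (P : nat -> Prop) :
  P 0 -> P 1 -> (forall m, P m -> P m.+2) -> forall m, P m.
Proof.
move=> P0 P1 PS m; suff [] : P m /\ P m.+1 by [].
by elim: m => [|m [Pm Pm1]]; split=> //; apply: PS.
Qed.

Lemma coef0_bij C (F : forall m, {linear C m -> C m}) :
  (forall m, bijective (F m)) -> forall m, bijective (coef0 F m).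
Proof.
move=> Fbij; elim/nat_ind2 => [||m [G FK GK]]; [exact: Fbij|exact: Fbij|].
have [H HK KH] := Fbij m.+2.
exists (fun x : natural C m.+2 => (H x.1, G x.2) : natural C m.+2).
  by case=> x y; congr pair; [apply: HK|apply: FK].
by case=> x y; congr pair; [apply: KH|apply: GK].
Qed.

Lemma coefD_coef0 C D (F : forall m, {linear C m.+1 -> D m})
    (G : forall m, {linear C m -> C m}) (H : forall m, {linear D m -> D m}) :
  (forall m x, F m (G m.+1 x) = H m (F m x)) ->
  forall m x, coefD F m (coef0 G m.+1 x) = coef0 H m (coefD F m x).
Proof.
move=> FG; elim/nat_ind2 => [x|x|m IHm x]; [exact: FG|exact: FG|].
by congr pair; [apply: FG|apply: IHm].
Qed.

Lemma coefU_coef0 C D (F : forall m, {linear C m -> D m.+1})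
    (G : forall m, {linear C m -> C m}) (H : forall m, {linear D m -> D m}) :
  (forall m x, F m (G m x) = H m.+1 (F m x)) ->
  forall m x, coefU F m (coef0 G m x) = coef0 H m.+1 (coefU F m x).
Proof.
move=> FG; elim/nat_ind2 => [x|x|m IHm x]; first exact: FG.
  by congr pair; [apply: FG|rewrite /= linear0].
by congr pair; [apply: FG|apply: IHm].
Qed.

Section Natural.
Variable C : parachain.
Local Notation b := (coefD (pch_b C)).
Local Notation B := (coefU (pch_B C)).
Local Notation T := (coef0 (pch_T C)).

Lemma pch_bT m (x : C m.+1) : pch_b C m (pch_T C m.+1 x) = pch_T C m (pch_b C m x).
Proof.
rewrite /= linearB linearD /= pch_bb add0r; congr (_ - _).
by case: m x => [|m] x /=; rewrite ?pch_bb ?linear0 addr0.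
Qed.

Lemma pch_BT m (x : C m) : pch_B C m (pch_T C m x) = pch_T C m.+1 (pch_B C m x).
Proof.
rewrite /= linearB linearD /= pch_BB linear0 add0r; congr (_ - _).
by case: m x => [|m] x /=; rewrite ?pch_BB ?linear0 addr0.
Qed.

Lemma coef_bb m (x : natural C m.+2) : b m (b m.+1 x) = 0.
Proof.
elim/nat_ind2: m x => [x|x|m IHm x]; [exact: pch_bb|exact: pch_bb|].
by congr pair; [apply: pch_bb|apply: IHm].
Qed.

Lemma coef_BB m (x : natural C m) : B m.+1 (B m x) = 0.
Proof.
elim/nat_ind2: m x => [x|x|m IHm x].
- by congr pair; apply: pch_BB.
- by congr pair; [apply: pch_BB|rewrite /= linear0].
- by congr pair; [apply: pch_BB|apply: IHm].
Qed.

Lemma coef_TE m (x : natural C m) : T m x = x - (b m (B m x) + updown B b m x).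
Proof.
elim/nat_ind2: m x => [x|x|m IHm [x y]] //.
congr pair; rewrite /= ?IHm; congr (_ - (_ + _)).
  by case: m {IHm} x y.
by case: m {IHm} x y.
Qed.

Definition natural_data : paraS_data :=
  {| ps_mod := natural C;
     ps_d m := b m \+ mul_uinv B m;
     ps_S := uinv C;
     ps_T := T |}.

Fact natural_is_paraS : is_paraS natural_data.
Proof.
split=> /=.
- exact: (coef0_bij (@pch_T_bij _)).
- move=> m x; rewrite linearD /= coef_bb add0r.
  rewrite [RHS](_ : _ = uinv C m x - T m (uinv C m x)) // coef_TE subKr.
  congr (_ + _); case: m x => [|m] x //=.
  case: m x => [|m] [x y]; first by rewrite /= addr0.
  rewrite [LHS](_ : _ = B m.+1 (b m.+1 y + B m (uinv C m y))) //.
  by rewrite linearD coef_BB addr0.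
- by move=> m x; case: m x => [|m] x.
- move=> m x; rewrite linearD (coefD_coef0 pch_bT); congr (_ + _).
  case: m x => [|m] x; first exact/esym/(linear0 (T 0)).
  exact: (coefU_coef0 pch_BT).
- by [].
Qed.

Definition paraS_natural : paraS := ParaS natural_is_paraS.

End Natural.

Section Perturbation.
Variables C Cb : parachain.
Variables (f : forall m, {linear C m -> Cb m}) (g : forall m, {linear Cb m -> C m}).
Variable phi : forall m, {linear C m -> C m.+1}.

Local Notation B := (coefU (pch_B C)).
Local Notation f' := (coef0 f).
Local Notation g' := (coef0 g).
Local Notation phi' := (coefU phi).

Definition Bphi_nat m : {linear natural C m -> natural C m.+2} := B m.+1 \o phi' m.
Definition phiB_nat m : {linear natural C m -> natural C m.+2} := phi' m.+1 \o B m.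
Definition Bg_nat m : {linear natural Cb m -> natural C m.+1} := B m \o g' m.

(* [u^{-j}] vanishes in degree m for j > m/2, so all the series stop there. *)

Definition phi_nat_fun m (x : natural C m) : natural C m.+1 :=
  \sum_(0 <= j < m./2.+1) phi' m (pow_uinv Bphi_nat (fun m => idfun) j m x).

Definition f_nat_fun m (x : natural C m) : natural Cb m :=
  f' m x +
  \sum_(1 <= j < m./2.+1) f' m (pow_uinv Bphi_nat (fun m => idfun) j m x).

Definition g_nat_fun m (y : natural Cb m) : natural C m :=
  g' m y + \sum_(1 <= j < m./2.+1) pow_uinv phiB_nat g' j m y.

Definition B_tilde_fun m (y : natural Cb m) : natural Cb m.+1 :=
  \sum_(0 <= j < m./2.+1)
    f' m.+1 (@pow_uinv Cb (fun m => natural C m.+1) (fun m => Bphi_nat m.+1) Bg_nat j m y).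

Fact sum_linear (U V : lmodType k) (F : nat -> {linear U -> V}) a n :
  linear (fun x => \sum_(a <= j < n) F j x).
Proof.
move=> c x y; rewrite scaler_sumr -big_split /=.
by apply: eq_bigr => j _; rewrite linearP.
Qed.

Fact phi_nat_linear m : linear (@phi_nat_fun m).
Proof. exact: (sum_linear (fun j => phi' m \o pow_uinv Bphi_nat (fun m => idfun) j m)). Qed.
Definition phi_nat m : {linear natural C m -> natural C m.+1} :=
  mklin (@phi_nat_linear m).

Fact f_nat_linear m : linear (@f_nat_fun m).
Proof.
move=> a x y; rewrite /f_nat_fun linearP.
rewrite (sum_linear (fun j => f' m \o pow_uinv Bphi_nat (fun m => idfun) j m)).
by rewrite scalerDr addrACA.
Qed.
Definition f_nat m : {linear natural C m -> natural Cb m} :=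
  mklin (@f_nat_linear m).

Fact g_nat_linear m : linear (@g_nat_fun m).
Proof.
move=> a x y; rewrite /g_nat_fun linearP.
by rewrite (sum_linear (pow_uinv phiB_nat g' ^~ m)) scalerDr addrACA.
Qed.
Definition g_nat m : {linear natural Cb m -> natural C m} :=
  mklin (@g_nat_linear m).

Fact B_tilde_linear m : linear (@B_tilde_fun m).
Proof.
exact: (sum_linear (fun j => f' m.+1 \o
  @pow_uinv Cb (fun m => natural C m.+1) (fun m => Bphi_nat m.+1) Bg_nat j m)).
Qed.
Definition B_tilde m : {linear natural Cb m -> natural Cb m.+1} :=
  mklin (@B_tilde_linear m).

Definition tilde_data : paraS_data :=
  {| ps_mod := natural Cb;
     ps_d m := coefD (pch_b Cb) m \+ mul_uinv B_tilde m;
     ps_S := uinv Cb;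
     ps_T := coef0 (pch_T Cb) |}.

End Perturbation.

End Graded.

(* Main.v *)
From HB Require Import structures.
From mathcomp Require Import all_boot all_order all_algebra.
From mathcomp Require Import boolp.
Require Import Defs.

Set Implicit Arguments.
Unset Strict Implicit.
Unset Printing Implicit Defensive.

Import GRing.Theory.
Local Open Scope ring_scope.

(** This is the basic perturbation lemma of homological algebra, in a version
where the differential squares to something other than zero.

Write X = B u^{-1}.  On C^natural the operator X phi is locally nilpotent, since
u^{-1} is, so that A = (1 - X phi)^{-1} exists and is the Neumann series
sum_j (B phi)^j u^{-j}.  The four series of the statement are then
  phi^natural = phi A,   f^natural = f A,   g^natural = g + phi A X g
and tilde B u^{-1} = f A X g.  They are what perturbing the differential b into
b + X turns phi, f, g and b into.  Instead of (b + X)^2 = 0 one only has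
(b + X)^2 = z with z = u^{-1} (1 - T), but z commutes with everything in
sight.  In the computations z appears only next to phi, as in phi z phi, f z phi
or phi z g, and these vanish because z commutes with phi, f, g and phi is
special; every other term cancels as for a genuine complex.  That
(b + tilde B u^{-1})^2 = z comes for free, since b + tilde B u^{-1} is
f^natural (b + X) g^natural.

The algebra is carried out once, for additive endomorphisms of an abelian group
([is_perturbation] and the lemmas on it).  To make a graded module an instance,
all its degrees are gathered in their product [total]: operators of any degree
become endomorphisms, and the components in negative degree, being zero, need no
separate treatment.  The identities satisfied by A and by the series above reduce
to recursions along u^{-1}, which determine their solutions ([up_up_fixpoint]).
Finally an S-deformation retract induces a T-deformation retract on inverse limits
because its maps and homotopy commute with S ([sharp_deformation_retract]). *)

(** * Perturbation of a deformation retract *)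

(** The complex (V, b) retracts to (W, bW) with special homotopy phi, and b is
perturbed by X.  The endomorphism z is the defect of b + X from being a
differential, zW its counterpart on W, and A is an inverse of 1 - X phi. *)
Record is_perturbation (V W : zmodType) (b X phi A : {additive V -> V})
    (bW : {additive W -> W}) (f : {additive V -> W}) (g : {additive W -> V})
    (z : V -> V) (zW : W -> W) : Prop := IsPerturbation {
  pb_fb : forall v, f (b v) = bW (f v);
  pb_gb : forall w, g (bW w) = b (g w);
  pb_fg : forall w, f (g w) = w;
  pb_gf : forall v, g (f v) = v + b (phi v) + phi (b v);
  pb_fphi : forall v, f (phi v) = 0;
  pb_phig : forall w, phi (g w) = 0;
  pb_phiphi : forall v, phi (phi v) = 0;
  pb_bb : forall v, b (b v) = 0;
  pb_DD : forall v, b (b v + X v) + X (b v + X v) = z v;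
  pb_zphi : forall v, z (phi v) = phi (z v);
  pb_zA : forall v, A (z v) = z (A v);
  pb_zf : forall v, f (z v) = zW (f v);
  pb_AXphi : forall v, A v = v + A (X (phi v));
  pb_XphiA : forall v, A v = v + X (phi (A v)) }.

Section BasicPerturbation.
Variables (V W : zmodType) (b X phi A : {additive V -> V}) (bW : {additive W -> W}).
Variables (f : {additive V -> W}) (g : {additive W -> V}).
Variables (z : V -> V) (zW : W -> W).
Hypothesis pP : is_perturbation b X phi A bW f g z zW.
Let fb := pb_fb pP.
Let gb := pb_gb pP.
Let fg := pb_fg pP.
Let gf := pb_gf pP.
Let fphi := pb_fphi pP.
Let phig := pb_phig pP.
Let phiphi := pb_phiphi pP.
Let bb := pb_bb pP.
Let DD := pb_DD pP.
Let zphi := pb_zphi pP.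
Let zA := pb_zA pP.
Let zf := pb_zf pP.
Let AXphi := pb_AXphi pP.
Let XphiA := pb_XphiA pP.

Definition pert_f v := f (A v).
Definition pert_g w := g w + phi (A (X (g w))).
Definition pert_phi v := phi (A v).
Definition pert_dV v := b v + X v.
Definition pert_dW w := bW w + f (A (X (g w))).

(** Since A = 1 + A X phi, and phi kills its own image and that of g, A fixes
both images pointwise. *)
Lemma A_phi v : A (phi v) = phi v.
Proof. by rewrite AXphi phiphi !raddf0 addr0. Qed.

Lemma A_g w : A (g w) = g w.
Proof. by rewrite AXphi phig !raddf0 addr0. Qed.

(** The form in which (b + X)^2 = z is used: it moves b to the right of X. *)
Lemma b_X_XX v : b (X v) + X (X v) = z v - X (b v).
Proof. by rewrite -DD !raddfD bb add0r addrCA addrAC subrr add0r. Qed.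

Lemma X_pert_g w : X (pert_g w) = A (X (g w)).
Proof. by rewrite raddfD -XphiA. Qed.

Lemma pert_f_phi v : pert_f (pert_phi v) = 0.
Proof. by rewrite /pert_f A_phi fphi. Qed.

Lemma pert_phi_g w : pert_phi (pert_g w) = 0.
Proof. by rewrite /pert_phi raddfD A_g A_phi raddfD phig phiphi addr0. Qed.

Lemma pert_phi_phi v : pert_phi (pert_phi v) = 0.
Proof. by rewrite /pert_phi A_phi phiphi. Qed.

Lemma pert_f_g w : pert_f (pert_g w) = w.
Proof. by rewrite /pert_f raddfD A_g A_phi raddfD fg fphi addr0. Qed.

Lemma A_sub v : A (v - X (phi v)) = v.
Proof. by rewrite raddfB {1}AXphi addrK. Qed.

(** Since A inverts 1 - X phi, identities involving A v may be checked on
v = w - X phi w, where A v is simply w. *)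
Lemma A_presentation v : exists w, v = w - X (phi w) /\ A v = w.
Proof. by exists (A v); split=> //; rewrite {1}XphiA addrK. Qed.

Lemma A_dV_sub v : A (pert_dV (v - X (phi v))) =
  A (b v) + A (X v) + A (X (b (phi v))) - phi (z v).
Proof.
rewrite /pert_dV raddfB [X (_ - _)]raddfB addrACA -opprD b_X_XX opprB addrC.
by rewrite !raddfD raddfN /= zphi A_phi addrC addrA.
Qed.

(** Both sides are compared at w - X phi w.  There z enters only through a term
phi (z w), which f kills. *)
Lemma pert_f_d v : pert_f (pert_dV v) = pert_dW (pert_f v).
Proof.
have [w [-> Aw]] := A_presentation v.
rewrite /pert_f A_dV_sub A_sub /pert_dW gf !raddfD raddfN /= fphi subr0 -fb.
rewrite (AXphi (b w)) !raddfD /= -!addrA; congr (_ + _).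
by rewrite addrC -!addrA.
Qed.



Lemma AXphiE v : A (X (phi v)) = A v - v.
Proof. by rewrite [A v]AXphi addrC addKr. Qed.

Lemma pert_g_d w : pert_g (pert_dW w) = pert_dV (pert_g w).
Proof.
set y := A (X (g w)); set p := pert_g w.
have Xp : X p = y by rewrite X_pert_g.
(* With y = X p the argument of A is X b p + X X p + b X p = z p, and phi A z p
   = z (phi A p) = 0 because phi A p is the perturbed homotopy on p. *)
have zp0 : phi (A (X (b p + y) + b y)) = 0.
  rewrite -Xp [X (_ + _)]raddfD -addrA [X (X p) + _]addrC b_X_XX addrC subrK zA -zphi.
  by rewrite [phi (A p)]pert_phi_g -DD !(raddf0, addr0).
have bpE : b p = b (g w) + b (phi y) by rewrite -raddfD.
rewrite {1}/pert_g /pert_dW -/y raddfD gb gf /pert_dV Xp.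
have -> : b (g w) + (y + b (phi y) + phi (b y)) = b p + y + phi (b y).
  by rewrite bpE -!addrA; congr (_ + _); rewrite addrCA.
rewrite [X (b p + y + _)]raddfD raddfD /= AXphiE addrA -raddfD raddfB zp0 sub0r.
by rewrite addrK.
Qed.

Lemma pert_g_f v :
  pert_g (pert_f v) = v + pert_dV (pert_phi v) + pert_phi (pert_dV v).
Proof.
have [w [-> Aw]] := A_presentation v.
rewrite /pert_phi A_dV_sub /pert_f /pert_g A_sub gf /pert_dV.
have -> : phi (A (X (w + b (phi w) + phi (b w)))) =
  phi (A (b w) + A (X w) + A (X (b (phi w)))) - phi (b w).
  rewrite !raddfD /= AXphiE raddfB /= addrA; congr (_ - _).
  by rewrite addrC addrA.
rewrite raddfB phiphi subr0 addrA addrAC addrK; congr (_ + _).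
by rewrite addrA addrAC subrK.
Qed.

(** As f A is a left inverse of [pert_g] and intertwines the differentials,
the square on W is transported from the square z on V. *)
Lemma pert_dW_pert_dW w : pert_dW (pert_dW w) = zW w.
Proof.
rewrite -[w in LHS]pert_f_g -!pert_f_d [pert_dV (pert_dV _)]DD /pert_f zA zf.
by rewrite [f _]pert_f_g.
Qed.

(** Applied below to u^{-1} and to T; this gives the remaining axioms of
para-S-modules and of S-maps. *)
Section Commuting.
Variables (cV : {additive V -> V}) (cW : {additive W -> W}).
Hypothesis cb : forall v, cV (b v) = b (cV v).
Hypothesis cbW : forall w, cW (bW w) = bW (cW w).
Hypothesis cX : forall v, cV (X v) = X (cV v).
Hypothesis cA : forall v, cV (A v) = A (cV v).
Hypothesis cphi : forall v, cV (phi v) = phi (cV v).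
Hypothesis cf : forall v, cW (f v) = f (cV v).
Hypothesis cg : forall w, cV (g w) = g (cW w).

Lemma pert_f_comm v : cW (pert_f v) = pert_f (cV v).
Proof. by rewrite /pert_f cf cA. Qed.
Lemma pert_g_comm w : cV (pert_g w) = pert_g (cW w).
Proof. by rewrite /pert_g raddfD cg cphi cA cX cg. Qed.
Lemma pert_phi_comm v : cV (pert_phi v) = pert_phi (cV v).
Proof. by rewrite /pert_phi cphi cA. Qed.
Lemma pert_dW_comm w : cW (pert_dW w) = pert_dW (cW w).
Proof. by rewrite /pert_dW raddfD cbW cf cA cX cg. Qed.
End Commuting.
End BasicPerturbation.

(** * The total space of a graded module *)

(** The product over all degrees; negative degrees contribute nothing. *)
Definition total (k : pzRingType) (C : nat -> lmodType k) : Type :=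
  forall m, C m.

Section Total.
Variable k : pzRingType.
Implicit Types C D E : nat -> lmodType k.

Lemma totalP C (x y : total C) : (forall m, x m = y m) -> x = y.
Proof. exact: functional_extensionality_dep. Qed.

Section Zmodule.
Variable C : nat -> lmodType k.
HB.instance Definition _ := gen_eqMixin (total C).
HB.instance Definition _ := gen_choiceMixin (total C).

Definition total_zero : total C := fun _ => 0.
Definition total_opp (x : total C) : total C := fun m => - x m.
Definition total_add (x y : total C) : total C := fun m => x m + y m.

Fact total_addA : associative total_add.
Proof. by move=> x y z; apply: totalP => m; apply: addrA. Qed.
Fact total_addC : commutative total_add.
Proof. by move=> x y; apply: totalP => m; apply: addrC. Qed.
Fact total_add0 : left_id total_zero total_add.
Proof. by move=> x; apply: totalP => m; apply: add0r. Qed.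
Fact total_addN : left_inverse total_zero total_opp total_add.
Proof. by move=> x; apply: totalP => m; apply: addNr. Qed.
HB.instance Definition _ :=
  GRing.isZmodule.Build (total C) total_addA total_addC total_add0 total_addN.

Lemma total_addE (x y : total C) m : (x + y) m = x m + y m. Proof. by []. Qed.
Lemma total_oppE (x : total C) m : (- x) m = - x m. Proof. by []. Qed.

(** Every element is a component of a total element, so that an identity between
operators on total spaces yields the identities in each degree. *)
Lemma total_at m (x : C m) : exists y : total C, y m = x.
Proof.
exists (fun n => if @eqP _ m n is ReflectT e then eq_rect m C x n e else 0).
by case: eqP => // e; rewrite (eq_axiomK e).
Qed.
End Zmodule.

Section Operators.
Variables C D : nat -> lmodType k.

Definition tot0 (F : forall m, {linear C m -> D m}) (x : total C) : total D :=
  fun m => F m (x m).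
Definition tot_down (F : forall m, {linear C m.+1 -> D m}) (x : total C) : total D :=
  fun m => F m (x m.+1).
Definition tot_down2 (F : forall m, {linear C m.+2 -> D m}) (x : total C) : total D :=
  fun m => F m (x m.+2).
Definition tot_up (F : forall m, {linear C m -> D m.+1}) (x : total C) : total D :=
  fun m => match m with 0 => 0 | m'.+1 => F m' (x m') end.

Fact tot0_additive F : zmod_morphism (tot0 F).
Proof. by move=> x y; apply: totalP => m; apply: linearB. Qed.
Fact tot_down_additive F : zmod_morphism (tot_down F).
Proof. by move=> x y; apply: totalP => m; apply: linearB. Qed.
Fact tot_down2_additive F : zmod_morphism (tot_down2 F).
Proof. by move=> x y; apply: totalP => m; apply: linearB. Qed.
Fact tot_up_additive F : zmod_morphism (tot_up F).
Proof.
move=> x y; apply: totalP => -[|m]; last exact: linearB.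
by rewrite /= total_addE total_oppE subr0.
Qed.
HB.instance Definition _ F := GRing.isZmodMorphism.Build _ _ (tot0 F) (@tot0_additive F).
HB.instance Definition _ F := GRing.isZmodMorphism.Build _ _ (tot_down F) (@tot_down_additive F).
HB.instance Definition _ F := GRing.isZmodMorphism.Build _ _ (tot_down2 F) (@tot_down2_additive F).
HB.instance Definition _ F := GRing.isZmodMorphism.Build _ _ (tot_up F) (@tot_up_additive F).
End Operators.

(** The recursion expresses degree m.+2 through degree m and starts from zero in
degrees 0 and 1.  Uniqueness of the solution of an inhomogeneous recursion follows
by taking for h the difference of two solutions. *)
Lemma up_up_fixpoint (Z : Type) (u : Z -> Z) C D
    (F : forall m, {linear D m -> C m.+1}) (G : forall m, {linear C m -> D m.+1})
    (h : Z -> total C) :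
  (forall z, h z = tot_up F (tot_up G (h (u z)))) -> forall z, h z = 0.
Proof.
move=> hE z; apply: totalP => m; elim/nat_ind2: m z => [||m IHm] z; rewrite hE //.
  exact: linear0.
by rewrite /= IHm !linear0.
Qed.

(** * Identities between operators acting on coefficients *)

Lemma coef0_coefD C C' D D' (F : forall m, {linear C m.+1 -> D m})
    (F' : forall m, {linear C' m.+1 -> D' m})
    (G : forall m, {linear C m -> C' m}) (H : forall m, {linear D m -> D' m}) :
  (forall m (x : C m.+1), H m (F m x) = F' m (G m.+1 x)) ->
  forall m (x : natural C m.+1), coef0 H m (coefD F m x) = coefD F' m (coef0 G m.+1 x).
Proof.
move=> FG; elim/nat_ind2 => [x|x|m IHm x]; [exact: FG|exact: FG|].
by congr pair; [apply: FG|apply: IHm].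
Qed.

Lemma coef0_coef0 C D D' E (F : forall m, {linear D m -> E m})
    (G : forall m, {linear C m -> D m}) (F' : forall m, {linear D' m -> E m})
    (G' : forall m, {linear C m -> D' m}) :
  (forall m (x : C m), F m (G m x) = F' m (G' m x)) ->
  forall m (x : natural C m), coef0 F m (coef0 G m x) = coef0 F' m (coef0 G' m x).
Proof.
move=> FG; elim/nat_ind2 => [x|x|m IHm x]; [exact: FG|exact: FG|].
by congr pair; [apply: FG|apply: IHm].
Qed.

Lemma coef0_cancel C D (F : forall m, {linear D m -> C m})
    (G : forall m, {linear C m -> D m}) :
  (forall m (x : C m), F m (G m x) = x) ->
  forall m (x : natural C m), coef0 F m (coef0 G m x) = x.
Proof.
move=> FG; elim/nat_ind2 => [x|x|m IHm [x y]]; [exact: FG|exact: FG|].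
by congr pair; [apply: FG|apply: IHm].
Qed.

Lemma coef0_coefU_eq0 C D E (F : forall m, {linear D m -> E m})
    (G : forall m, {linear C m -> D m.+1}) :
  (forall m (x : C m), F m.+1 (G m x) = 0) ->
  forall m (x : natural C m), coef0 F m.+1 (coefU G m x) = 0.
Proof.
move=> FG; elim/nat_ind2 => [x|x|m IHm x]; first exact: FG.
  by congr pair; [apply: FG|apply: linear0].
by congr pair; [apply: FG|apply: IHm].
Qed.

Lemma coefU_coef0_eq0 C D E (F : forall m, {linear D m -> E m.+1})
    (G : forall m, {linear C m -> D m}) :
  (forall m (x : C m), F m (G m x) = 0) ->
  forall m (x : natural C m), coefU F m (coef0 G m x) = 0.
Proof.
move=> FG; elim/nat_ind2 => [x|x|m IHm x]; first exact: FG.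
  by congr pair; apply: FG.
by congr pair; [apply: FG|apply: IHm].
Qed.

Lemma coefU_coefU_eq0 C D E (F : forall m, {linear D m -> E m.+1})
    (G : forall m, {linear C m -> D m.+1}) :
  (forall m (x : C m), F m.+1 (G m x) = 0) ->
  forall m (x : natural C m), coefU F m.+1 (coefU G m x) = 0.
Proof.
move=> FG; elim/nat_ind2 => [x|x|m IHm x].
- by congr pair; apply: FG.
- by congr pair; [apply: FG|apply: linear0].
- by congr pair; [apply: FG|apply: IHm].
Qed.

Lemma coef0_homotopy C D (f : forall m, {linear C m -> D m}) (g : forall m, {linear D m -> C m})
    (b : forall m, {linear C m.+1 -> C m}) (phi : forall m, {linear C m -> C m.+1}) :
  (forall m (x : C m), g m (f m x) = x + b m (phi m x) + updown phi b m x) ->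
  forall m (x : natural C m), coef0 g m (coef0 f m x) =
    x + coefD b m (coefU phi m x) + updown (coefU phi) (coefD b) m x.
Proof.
move=> gf; elim/nat_ind2 => [x|x|m IHm [x y]]; [exact: gf|exact: gf|].
rewrite [LHS](_ : _ = (g m.+2 (f m.+2 x), coef0 g m (coef0 f m y))) //.
rewrite gf IHm.
by case: m {IHm} x y => [|m] x y; congr pair.
Qed.
End Total.

(** * Passing to the periodic complexes *)

Section SharpRetract.
Variables (k : pzRingType) (X Y : paraS k).
Variables (f : forall m, {linear X m -> Y m}) (g : forall m, {linear Y m -> X m}).
Variable phi : forall m, {linear X m -> X m.+1}.
Hypothesis sdr : is_S_deformation_retract f g phi.

(** Componentwise this is the S-deformation retract.  The point to check is
the homotopy out of the odd part: there phi lands two degrees too high and is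
brought back by S, which commutes with phi.  For phi d in degree 0, where phi d is zero in X, the
vanishing of S phi in degree 1 is needed. *)
Lemma sharp_deformation_retract :
  is_T_deformation_retract
    (sharp_map0 (sdr_f sdr)) (sharp_map1 (sdr_f sdr))
    (sharp_map0 (sdr_g sdr)) (sharp_map1 (sdr_g sdr))
    (sharp_homotopy01 (sdr_phiS sdr)) (sharp_homotopy10 (sdr_phiS sdr)).
Proof.
split=> x; apply: invlimP => q /=.
- exact: (Smap_d (sdr_f sdr)).
- exact: (Smap_d (sdr_f sdr)).
- exact: (Smap_d (sdr_g sdr)).
- exact: (Smap_d (sdr_g sdr)).
- exact: (sdr_fg sdr).
- exact: (sdr_fg sdr).
- rewrite (sdr_gf sdr) -!addrA; congr (_ + (_ + _)).
  case: q => [|q]; first by rewrite /= (sdr_phiS1 sdr).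
  rewrite -(sdr_phiS sdr) -(ps_dS (ps_axioms X)).
  by rewrite (il_compat x q.+1).
- rewrite (sdr_gf sdr) -!addrA; congr (_ + (_ + _)).
  by rewrite -(sdr_phiS sdr) (il_compat x q).
- exact: (Smap_T (sdr_f sdr)).
- exact: (Smap_T (sdr_f sdr)).
- exact: (Smap_T (sdr_g sdr)).
- exact: (Smap_T (sdr_g sdr)).
- exact: (sdr_phiT sdr).
- by rewrite (sdr_phiT sdr) -[RHS](ps_ST (ps_axioms X)).
Qed.
End SharpRetract.

(** * The series as Neumann series *)

Section Uinv.
Variables (k : pzRingType) (C D : nat -> lmodType k).
Definition tot_uinv E : {additive total (natural E) -> total (natural E)} :=
  tot_down2 (@uinv k E).
Lemma uinv_tot0 (F : forall m, {linear C m -> D m}) (x : total (natural C)) :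
  tot_uinv D (tot0 (coef0 F) x) = tot0 (coef0 F) (tot_uinv C x).
Proof. by []. Qed.
Lemma uinv_tot_up (F : forall m, {linear C m -> D m.+1}) (x : total (natural C)) :
  tot_uinv D (tot_up (coefU F) x) = tot_up (coefU F) (tot_uinv C x).
Proof. by apply: totalP => -[|m]. Qed.
End Uinv.

Section Naturality.
Variables (k : pzRingType) (C Cb : parachain k).
Variables (f : forall m, {linear C m -> Cb m}) (g : forall m, {linear Cb m -> C m}).
Variable phi : forall m, {linear C m -> C m.+1}.

Local Notation V := (total (natural C)).
Local Notation W := (total (natural Cb)).
Local Notation tot_b C := (tot_down (coefD (pch_b C))).
Local Notation tot_B := (tot_up (coefU (pch_B C))).
Local Notation tot_T C := (tot0 (coef0 (pch_T C))).
Local Notation tot_phi := (tot_up (coefU phi)).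
Local Notation tot_f := (tot0 (coef0 f)).
Local Notation tot_g := (tot0 (coef0 g)).

Definition tot_Bu : {additive V -> V} := tot_B \o tot_uinv C.

(** The inverse of 1 - B phi u^{-1}; the truncation at m./2 loses nothing because
u^{-j} vanishes in degree m for j > m/2. *)
Definition neumann m : {linear natural C m -> natural C m} :=
  mklin (@sum_linear _ _ _
    (fun j => pow_uinv (Bphi_nat phi) (fun m => idfun) j m) 0 m./2.+1).

Lemma neumannE m x : neumann m x =
  \sum_(0 <= j < m./2.+1) pow_uinv (Bphi_nat phi) (fun m => idfun) j m x.
Proof. by []. Qed.

Definition tot_neumann : {additive V -> V} := tot0 neumann.

(** Splitting off the term j = 0 of the series.  The order of B phi and u^{-1}
around A is the one given by the series; [tot_neumann_left] rearranges it. *)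
Lemma tot_neumann_rec (x : V) :
  tot_neumann x = x + tot_B (tot_phi (tot_neumann (tot_uinv C x))).
Proof.
apply: totalP => -[|[|m]]; rewrite total_addE.
- by rewrite [LHS]big_nat1 addr0.
- by rewrite [LHS]big_nat1 [X in _ + X]linear0 addr0.
rewrite [LHS]big_nat_recl //; congr (_ + _).
transitivity (coefU (pch_B C) m.+1 (coefU phi m (neumann m (uinv C m (x m.+2))))) => //.
by rewrite neumannE !linear_sum.
Qed.

(** The commutator of c with A satisfies the homogeneous recursion, hence is
zero. *)
Lemma tot_neumann_comm (c : {additive V -> V}) :
    (forall x, c (tot_uinv C x) = tot_uinv C (c x)) ->
    (forall x, c (tot_B x) = tot_B (c x)) ->
    (forall x, c (tot_phi x) = tot_phi (c x)) ->
  forall x, c (tot_neumann x) = tot_neumann (c x).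
Proof.
move=> cU cB cphi x; apply/eqP; rewrite -subr_eq0; apply/eqP; move: x.
apply: (up_up_fixpoint (u := tot_uinv C) (F := coefU (pch_B C))
  (G := coefU phi)) => x.
rewrite {1}tot_neumann_rec [tot_neumann (c x)]tot_neumann_rec -cU raddfD cB cphi.
by rewrite opprD addrACA subrr add0r -!raddfB.
Qed.

Lemma tot_neumann_uinv x : tot_uinv C (tot_neumann x) = tot_neumann (tot_uinv C x).
Proof. by apply: tot_neumann_comm => // y; rewrite uinv_tot_up. Qed.


Lemma tot_Bu_phi (x : V) : tot_Bu (tot_phi x) = tot_B (tot_phi (tot_uinv C x)).
Proof. by rewrite -(uinv_tot_up phi). Qed.

Lemma tot_Bu_uinv (x : V) : tot_uinv C (tot_Bu x) = tot_Bu (tot_uinv C x).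
Proof. exact: uinv_tot_up. Qed.

Lemma tot_neumann_left (x : V) : tot_neumann x = x + tot_Bu (tot_phi (tot_neumann x)).
Proof. by rewrite tot_Bu_phi tot_neumann_uinv -tot_neumann_rec. Qed.

Lemma tot_neumann_right (x : V) : tot_neumann x = x + tot_neumann (tot_Bu (tot_phi x)).
Proof.
apply/eqP; rewrite -subr_eq0; apply/eqP; move: x.
apply: (up_up_fixpoint (u := tot_uinv C) (F := coefU (pch_B C))
  (G := coefU phi)) => x.
rewrite {1}tot_neumann_rec opprD addrACA subrr add0r !tot_Bu_phi.
rewrite [tot_neumann (tot_B _)]tot_neumann_rec (uinv_tot_up (pch_B C)) (uinv_tot_up phi).
by rewrite -!(raddfD, raddfB).
Qed.

(** The next lemmas identify the operators of the statement with the perturbed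
ones.  For f and phi this is only the linearity of f and phi; for g and for
tilde B, where the powers stand on the other side or the series is of another
degree, both sides satisfy the same recursion. *)
Lemma tot_f_nat (x : V) : tot0 (f_nat f phi) x = tot_f (tot_neumann x).
Proof.
apply: totalP => m; transitivity (coef0 f m (neumann m (x m))) => //.
by rewrite neumannE big_ltn // linearD linear_sum.
Qed.

Lemma tot_phi_nat (x : V) : tot_up (phi_nat phi) x = tot_phi (tot_neumann x).
Proof.
apply: totalP => -[|m] //; transitivity (coefU phi m (neumann m (x m))) => //.
by rewrite neumannE linear_sum.
Qed.

Lemma tot_g_nat_rec (y : W) : tot0 (g_nat g phi) y =
  tot_g y + tot_phi (tot_B (tot0 (g_nat g phi) (tot_uinv Cb y))).
Proof.
have gE m (w : natural Cb m) : g_nat g phi m w =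
    \sum_(0 <= j < m./2.+1) pow_uinv (phiB_nat phi) (coef0 g) j m w.
  by rewrite big_ltn.
apply: totalP => -[|[|m]]; rewrite total_addE {1}/tot0 gE.
- by rewrite [LHS]big_nat1 addr0.
- by rewrite [LHS]big_nat1 [X in _ + X]linear0 addr0.
rewrite big_nat_recl //; congr (_ + _).
transitivity (coefU phi m.+1 (coefU (pch_B C) m
  (g_nat g phi m (uinv Cb m (y m.+2))))) => //.
by rewrite gE !linear_sum.
Qed.

Lemma tot_g_nat (y : W) :
  tot0 (g_nat g phi) y = tot_g y + tot_phi (tot_neumann (tot_Bu (tot_g y))).
Proof.
apply/eqP; rewrite -subr_eq0; apply/eqP; move: y.
apply: (up_up_fixpoint (u := tot_uinv Cb) (F := coefU phi)
  (G := coefU (pch_B C))) => y.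
rewrite {1}tot_g_nat_rec opprD addrACA subrr add0r.
rewrite [tot_neumann (tot_Bu _)]tot_neumann_rec tot_Bu_uinv (uinv_tot0 g).
rewrite [tot_Bu (tot_g y)](_ : _ = tot_B (tot_g (tot_uinv Cb y))) //.
by rewrite -!(raddfD, raddfB).
Qed.

(** A B g, of degree 1, so that tilde B is f applied to it. *)
Definition neumann_Bg m : {linear natural Cb m -> natural C m.+1} :=
  mklin (@sum_linear _ _ _
    (fun j => @pow_uinv _ Cb (fun m => natural C m.+1) (fun m => Bphi_nat phi m.+1)
       (Bg_nat g) j m) 0 m./2.+1).

Lemma neumann_BgE m w : neumann_Bg m w = \sum_(0 <= j < m./2.+1)
  @pow_uinv _ Cb (fun m => natural C m.+1) (fun m => Bphi_nat phi m.+1) (Bg_nat g) j m w.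
Proof. by []. Qed.

Lemma tot_neumann_Bg_rec (y : W) : tot_up neumann_Bg y =
  tot_B (tot_g y) + tot_B (tot_phi (tot_up neumann_Bg (tot_uinv Cb y))).
Proof.
apply: totalP => -[|[|[|m]]]; rewrite total_addE.
- by rewrite addr0.
- by rewrite [LHS]big_nat1 [X in _ + X]linear0 addr0.
(* Here the recursive term is B phi applied to the component in degree 0 of
   an image of [tot_up], which is zero. *)
- rewrite [LHS]big_nat1 (_ : tot_up (coefU (pch_B C)) (tot_phi _) 2 = 0) ?addr0 //.
  by rewrite /= !linear0.
rewrite [LHS]big_nat_recl //; congr (_ + _).
transitivity (coefU (pch_B C) m.+2 (coefU phi m.+1
  (neumann_Bg m (uinv Cb m (y m.+2))))) => //.
by rewrite neumann_BgE !linear_sum.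
Qed.

Lemma tot_neumann_Bg (y : W) : tot_up neumann_Bg y = tot_neumann (tot_B (tot_g y)).
Proof.
apply/eqP; rewrite -subr_eq0; apply/eqP; move: y.
apply: (up_up_fixpoint (u := tot_uinv Cb) (F := coefU (pch_B C))
  (G := coefU phi)) => y.
rewrite tot_neumann_Bg_rec [tot_neumann _]tot_neumann_rec (uinv_tot_up (pch_B C)).
by rewrite opprD addrACA subrr add0r -!raddfB.
Qed.

Lemma tot_d_tilde (y : W) : tot_down (ps_d (tilde_data f g phi)) y =
  tot_b Cb y + tot_f (tot_neumann (tot_Bu (tot_g y))).
Proof.
rewrite (_ : tot_Bu _ = tot_B (tot_g (tot_uinv Cb y))) // -tot_neumann_Bg.
apply: totalP => -[|m]; rewrite total_addE //; congr (_ + _).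
  exact/esym/linear0.
transitivity (coef0 f m.+1 (neumann_Bg m (uinv Cb m (y m.+2)))) => //.
by rewrite neumann_BgE linear_sum.
Qed.

Lemma tot_d_natural (x : V) : tot_down (ps_d (paraS_natural C)) x =
  tot_b C x + tot_Bu x.
Proof. by apply: totalP => -[|m]. Qed.

End Naturality.

(** * The perturbed retract of a parachain complex *)

Theorem lemma7p9 (k : pzRingType) (C Cb : parachain k)
    (f : forall m, {linear C m -> Cb m})
    (g : forall m, {linear Cb m -> C m})
    (phi : forall m, {linear C m -> C m.+1})
    (f_b : forall m (x : C m.+1), f m (pch_b C m x) = pch_b Cb m (f m.+1 x))
    (g_b : forall m (y : Cb m.+1), g m (pch_b Cb m y) = pch_b C m (g m.+1 y))
    (fg : forall m (y : Cb m), f m (g m y) = y)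
    (gf : forall m (x : C m),
       g m (f m x) = x + pch_b C m (phi m x) + updown phi (pch_b C) m x)
    (f_T : forall m (x : C m), f m (pch_T C m x) = pch_T Cb m (f m x))
    (g_T : forall m (y : Cb m), g m (pch_T Cb m y) = pch_T C m (g m y))
    (phi_T : forall m (x : C m), phi m (pch_T C m x) = pch_T C m.+1 (phi m x))
    (f_phi : forall m (x : C m), f m.+1 (phi m x) = 0)
    (phi_g : forall m (y : Cb m), phi m (g m y) = 0)
    (phi_phi : forall m (x : C m), phi m.+1 (phi m x) = 0) :
  let Cn := paraS_natural C in
  let Ct := tilde_data f g phi in
  let fn := f_nat f phi in
  let gn := g_nat g phi in
  let phin := phi_nat phi in
  (* (i) *)
  is_paraS Ct /\
  (* (ii) *)
  (is_Smap (X := Cn) (Y := Ct) fn /\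
   is_Smap (X := Ct) (Y := Cn) gn /\
   (forall m (y : Ct m), fn m (gn m y) = y) /\
   (forall m (x : Cn m),
      gn m (fn m x) = x + ps_d Cn m (phin m x) + updown phin (ps_d Cn) m x) /\
   is_S_deformation_retract (X := Cn) (Y := Ct) fn gn phin /\
   (exists (Ct_paraS : is_paraS Ct)
           (sdr : is_S_deformation_retract (X := Cn) (Y := ParaS Ct_paraS)
                    fn gn phin),
      is_T_deformation_retract
        (X := sharp Cn) (Y := sharp (ParaS Ct_paraS))
        (sharp_map0 (sdr_f sdr)) (sharp_map1 (sdr_f sdr))
        (sharp_map0 (sdr_g sdr)) (sharp_map1 (sdr_g sdr))
        (sharp_homotopy01 (sdr_phiS sdr)) (sharp_homotopy10 (sdr_phiS sdr)))) /\
  (* (iii) *)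
  ((forall m (x : Cn m), fn m.+1 (phin m x) = 0) /\
   (forall m (y : Ct m), phin m (gn m y) = 0) /\
   (forall m (x : Cn m), phin m.+1 (phin m x) = 0)).
Proof.
move=> Cn Ct fn gn phin.
pose V := total (natural C); pose W := total (natural Cb).
pose b : {additive V -> V} := tot_down (coefD (pch_b C)).
pose bW : {additive W -> W} := tot_down (coefD (pch_b Cb)).
pose B : {additive V -> V} := tot_up (coefU (pch_B C)).
pose T : {additive V -> V} := tot0 (coef0 (pch_T C)).
pose TW : {additive W -> W} := tot0 (coef0 (pch_T Cb)).
pose h : {additive V -> V} := tot_up (coefU phi).
pose F : {additive V -> W} := tot0 (coef0 f).
pose G : {additive W -> V} := tot0 (coef0 g).
pose U : {additive V -> V} := tot_uinv C.
pose UW : {additive W -> W} := tot_uinv Cb.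
pose X : {additive V -> V} := tot_Bu C.
pose A : {additive V -> V} := tot_neumann phi.
have Tb v : T (b v) = b (T v) by apply: totalP => m; apply/esym/(coefD_coef0 (@pch_bT _ C)).
have TbW w : TW (bW w) = bW (TW w) by apply: totalP => m; apply/esym/(coefD_coef0 (@pch_bT _ Cb)).
have TB v : T (B v) = B (T v).
  apply: totalP => -[|m]; first exact: linear0.
  exact/esym/(coefU_coef0 (@pch_BT _ C)).
have Th v : T (h v) = h (T v).
  apply: totalP => -[|m]; first exact: linear0.
  exact/esym/(coefU_coef0 phi_T).
have TX v : T (X v) = X (T v) by exact: TB.
have TF v : TW (F v) = F (T v).
  by apply: totalP => m; apply: coef0_coef0 => n x; rewrite f_T.
have TG w : T (G w) = G (TW w).
  by apply: totalP => m; apply: coef0_coef0 => n x; rewrite g_T.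
have Ub v : U (b v) = b (U v) by [].
have UbW v : UW (bW v) = bW (UW v) by [].
have Uh v : U (h v) = h (U v) by exact: uinv_tot_up.
have UX v : U (X v) = X (U v) by exact: tot_Bu_uinv.
have UF v : UW (F v) = F (U v) by [].
have UG w : U (G w) = G (UW w) by [].
have UA v : U (A v) = A (U v) by exact: tot_neumann_uinv.
have TA v : T (A v) = A (T v) by exact: tot_neumann_comm.
have UT v : U (T v) = T (U v) by [].
(* The operators of the statement are the perturbed ones. *)
have dE v : tot_down (ps_d Cn) v = pert_dV b X v by exact: tot_d_natural.
have dWE w : tot_down (ps_d Ct) w = pert_dW X A bW F G w by exact: tot_d_tilde.
have fE v : tot0 fn v = pert_f A F v by exact: tot_f_nat.
have gE w : tot0 gn w = pert_g X h A G w by exact: tot_g_nat.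
have hE v : tot_up phin v = pert_phi h A v by exact: tot_phi_nat.
have pP : is_perturbation b X h A bW F G (fun v => U (v - T v)) (fun w => UW (w - TW w)).
  split.
  - by move=> v; apply: totalP => m; apply: coef0_coefD.
  - by move=> v; apply: totalP => m; apply: coef0_coefD.
  - by move=> w; apply: totalP => m; apply: coef0_cancel.
  - move=> v; apply: totalP => m; rewrite [LHS](coef0_homotopy gf).
    by rewrite !total_addE; congr (_ + _); case: m.
  - move=> v; apply: totalP => -[|m]; first exact: linear0.
    exact: coef0_coefU_eq0.
  - by move=> w; apply: totalP => -[|m] //; apply: coefU_coef0_eq0.
  - move=> v; apply: totalP => -[|[|m]] //; first exact: linear0.
    exact: coefU_coefU_eq0.
  - by move=> v; apply: totalP => m; apply: coef_bb.
  - move=> v; transitivity (pert_dV b X (pert_dV b X v)) => //; rewrite -!dE.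
    by apply: totalP => m; apply: (ps_dd (ps_axioms Cn)).
  - by move=> v; rewrite Th -raddfB Uh.
  - by move=> v; rewrite TA -raddfB UA.
  - by move=> v; rewrite TF -raddfB UF.
  - exact: tot_neumann_right.
  - exact: tot_neumann_left.
(* The rest reads off components in degree m of identities on total spaces, at
   a total element with the prescribed component. *)
have Ctax : is_paraS Ct.
  split.
  - exact: (coef0_bij (@pch_T_bij _ Cb)).
  - move=> m x; have [y <-] := total_at x.
    have := pert_dW_pert_dW pP y; rewrite -!dWE.
    exact: (congr1 (fun w : W => w m)).
  - move=> m x; have [y <-] := total_at x.
    have := pert_dW_comm UbW UX UA UF UG y; rewrite -!dWE => /esym.
    exact: (congr1 (fun w : W => w m)).
  - move=> m x; have [y <-] := total_at x.
    have := pert_dW_comm TbW TX TA TF TG y; rewrite -!dWE => /esym.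
    exact: (congr1 (fun w : W => w m)).
  - by [].
have fS : is_Smap (X := Cn) (Y := Ct) fn.
  split=> m x; have [y <-] := total_at x.
  - have := pert_f_d pP y; rewrite -dWE -dE -!fE.
    exact: (congr1 (fun w : W => w m)).
  - have := pert_f_comm UA UF y; rewrite -!fE => /esym.
    exact: (congr1 (fun w : W => w m)).
  - have := pert_f_comm TA TF y; rewrite -!fE => /esym.
    exact: (congr1 (fun w : W => w m)).
have gS : is_Smap (X := Ct) (Y := Cn) gn.
  split=> m x; have [y <-] := total_at x.
  - have := pert_g_d pP y; rewrite -dWE -dE -!gE.
    exact: (congr1 (fun w : V => w m)).
  - have := pert_g_comm UX UA Uh UG y; rewrite -!gE => /esym.
    exact: (congr1 (fun w : V => w m)).
  - have := pert_g_comm TX TA Th TG y; rewrite -!gE => /esym.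
    exact: (congr1 (fun w : V => w m)).
have fgn m (y : Ct m) : fn m (gn m y) = y.
  have [w <-] := total_at y; have := pert_f_g pP w; rewrite -fE -gE.
  exact: (congr1 (fun w : W => w m)).
have gfn m (x : Cn m) :
    gn m (fn m x) = x + ps_d Cn m (phin m x) + updown phin (ps_d Cn) m x.
  have [v <-] := total_at x; have := pert_g_f pP v; rewrite -gE -fE -!hE -!dE.
  by move/(congr1 (fun w : V => w m)); case: m x => [|m] x.
have sdr : is_S_deformation_retract (X := Cn) (Y := Ct) fn gn phin.
  have hUE v : U (tot_up phin v) = tot_up phin (U v) by rewrite !hE pert_phi_comm.
  split=> //.
  - move=> m x; have [y <-] := total_at x.
    exact/esym/(congr1 (fun w : V => w m.+1) (hUE y)).
  - move=> x; have [y <-] := total_at x.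
    exact: (congr1 (fun w : V => w 0) (hUE y)).
  - move=> m x; have [y <-] := total_at x.
    have := pert_phi_comm TA Th y; rewrite -!hE => /esym.
    exact: (congr1 (fun w : V => w m.+1)).
split=> //; split.
  by do 5!split=> //; exists Ctax, sdr; exact: sharp_deformation_retract.
split; [|split] => m x; have [y <-] := total_at x.
- have := pert_f_phi pP y; rewrite -hE -fE; exact: (congr1 (fun w : W => w m.+1)).
- have := pert_phi_g pP y; rewrite -hE -gE; exact: (congr1 (fun w : V => w m.+1)).
- have := pert_phi_phi pP y; rewrite -!hE; exact: (congr1 (fun w : V => w m.+2)).
Qed.
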